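(* For any positive odd integer $n$, we have $$\sum_{r=0}^{n-1}\frac{1}{1+\sin(2\pi r/n)+\cos(2\pi r/n)}=\left(\frac{-1}{n}\right)\frac n2,$$ $$\sum_{r=0}^{n-1}\frac{1}{1+\sin(\pi(2r+1)/n)-\cos(\pi(2r+1)/n)}=\left(\frac{-1}{n}\right)\frac n2,$$ $$\sum_{r=0}^{n-1}\sec\left(2\pi\frac rn\right)=\left(\frac{-1}{n}\right)n\quad\text{and}\quad\sum_{r=0}^{n-1}\sec\left(\pi\frac{2r+1}{n}\right)=-\left(\frac{-1}{n}\right)n.$$
   Context: For a positive odd integer $n$, $\left(\frac{\cdot}{n}\right)$ denotes the Jacobi symbol; in particular $\left(\frac{-1}{n}\right)=(-1)^{(n-1)/2}$. *)

(* Defs.v *)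
From HB Require Import structures.
From mathcomp Require Import all_boot all_order all_algebra.
From mathcomp Require Import reals trigo.
Set Implicit Arguments.
Unset Strict Implicit.
Unset Printing Implicit Defensive.
Import Order.TTheory GRing.Theory Num.Theory.
Local Open Scope ring_scope.

(* Intended for p an odd prime. *)
Definition legendre (a : int) (p : nat) : int :=
  if (p %| a)%Z then 0
  else if [exists x : 'I_p, (x%:Z ^+ 2 == a %[mod p])%Z] then 1
  else -1.

(* Intended for n odd and positive. The empty product gives jacobi a 1 = 1. *)
Definition jacobi (a : int) (n : nat) : int :=
  \prod_(p <- primes n) legendre a p ^+ logn p n.

Definition sec {R : realType} (x : R) : R := (cos x)^-1.

(* Main.v *)
Require Import Defs.
From mathcomp Require Import all_boot all_order all_algebra.
From mathcomp Require Import reals trigo.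
From mathcomp Require Import finfield ring lra zify.
Import Order.TTheory GRing.Theory Num.Theory.
Local Open Scope ring_scope.

(* If n t is a multiple of 2 pi and n is odd, the alternating sum of the
   cos ((2 k + 1) t), k < n, telescopes after multiplication by cos t and equals
   sec t. Summing over the n-th roots of unity kills every k except the one with
   2 k + 1 = n, whose sign is (-1)^((n - 1) / 2), the value of the Jacobi symbol.
   The sums with sin and cos in the denominator reduce to the secant sum up to an
   odd summand, and the sums over odd multiples of pi / n reduce to the others
   by a translation by pi. *)

(** * The Jacobi symbol at -1 *)

Lemma Fp_sqrtN1 (p : nat) : prime p -> odd p ->
  [exists y : 'F_p, y ^+ 2 == -1] = ~~ odd p./2.
Proof.
move=> p_pr p_odd; have p_gt1 := prime_gt1 p_pr.
have pE : p = (p./2.*2).+1 by rewrite -[LHS]odd_double_half p_odd.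
have fermat (y : 'F_p) : y != 0 -> y ^+ (p./2.*2) = 1.
  move=> y0; apply: (mulfI y0); rewrite mulr1 -exprS.
  by rewrite -[RHS]expf_card card_Fp //; congr (_ ^+ _).
have N1 : (-1 : 'F_p) != 1.
  rewrite eq_sym -subr_eq0 opprK -[1 + 1]/(2%:R).
  rewrite -(dvdn_pcharf (pchar_Fp p_pr)); apply/negP => /dvdn_leq => /(_ isT). lia.
apply/idP/idP => [/existsP[y /eqP y2]|p4].
  (* If [p./2] were odd, raising [y ^+ 2 = -1] to the power [p./2] would give [1 = -1] by Fermat. *)
  apply: contra N1 => p4; apply/eqP.
  have y0 : y != 0.
    by apply: contra_eqN y2 => /eqP ->; rewrite expr0n eq_sym oppr_eq0 oner_eq0.
  by rewrite -[RHS](fermat y y0) -mul2n exprM y2 -signr_odd p4 expr1.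
(* ['X^(p./2) - 1] has at most [p./2] roots, fewer than the [p - 1] nonzero elements. For a non-root
   [y], Fermat forces [y ^+ p./2 = -1], and since [p./2] is even, [y ^+ p./2./2] is a square root of
   -1. *)
have [y y0 yN1] : exists2 y : 'F_p, y != 0 & y ^+ p./2 != 1.
  apply/exists_inP; apply: contraT; rewrite negb_exists_in => /forall_inP H.
  have P0 : 'X^(p./2) - 1 != 0 :> {poly 'F_p}.
    by rewrite -size_poly_gt0 size_XnsubC //; lia.
  have := max_poly_roots (rs := enum (predC1 (0 : 'F_p))) P0.
  rewrite enum_uniq -cardE cardC1 card_Fp // size_XnsubC; last lia.
  have -> : all (root ('X^(p./2) - 1)) (enum (predC1 (0 : 'F_p))).
    apply/allP => y; rewrite mem_enum inE => /H; rewrite negbK => /eqP y1.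
    by rewrite /root !hornerE y1 subrr.
  by move/(_ isT isT); lia.
apply/existsP; exists (y ^+ p./2./2).
have yE : (y ^+ p./2./2) ^+ 2 = y ^+ p./2.
  by rewrite -exprM muln2; congr (_ ^+ _); lia.
have := fermat y y0; rewrite -muln2 exprM yE => /eqP.
by rewrite sqrf_eq1 (negbTE yN1).
Qed.

Lemma legendreN1 (p : nat) : prime p -> odd p -> legendre (-1) p = (-1) ^+ p./2.
Proof.
move=> p_pr p_odd; have p_gt1 := prime_gt1 p_pr.
have -> : legendre (-1) p = if [exists y : 'F_p, y ^+ 2 == -1] then 1 else -1.
  rewrite /legendre dvdzE /= dvdn1 gtn_eqF //; congr (if _ then _ else _).
  have key (k : nat) : (k%:Z ^+ 2 == -1 %[mod p])%Z = (k%:R ^+ 2 == -1 :> 'F_p).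
    rewrite eqz_mod_dvd opprK -addr_eq0.
    rewrite -[_ + 1]/((k ^ 2 + 1)%N%:Z) dvdzE /=.
    by rewrite (dvdn_pcharf (pchar_Fp p_pr)) natrD natrX.
  apply/existsP/existsP => [[x]|[y]].
    by rewrite key => y2; exists (x : nat)%:R.
  (* ['F_p] is an ordinal type whose bound equals [p] only propositionally, hence the cast. *)
  have yp : (y < p)%N by rewrite -[X in (_ < X)%N](Fp_cast p_pr).
  by move=> y2; exists (Ordinal yp); rewrite key /= natr_Zp.
by rewrite Fp_sqrtN1 // -signr_odd; case: (odd _).
Qed.

(** For [m = 2a + 1] and [n = 2b + 1], half of [m * n] is [2ab + a + b], of the parity of [a + b].
    This carries the value at -1 from primes to all odd [n]. *)
Lemma signr_halfM (m n : nat) : odd m -> odd n ->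
  (-1) ^+ (m * n)./2 = (-1) ^+ m./2 * (-1) ^+ n./2 :> int.
Proof.
move=> m_odd n_odd; rewrite -exprD -signr_odd -[RHS]signr_odd; congr (_ ^+ _).
have -> : m = (m./2.*2).+1 by rewrite -[LHS]odd_double_half m_odd.
have -> : n = (n./2.*2).+1 by rewrite -[LHS]odd_double_half n_odd.
set a := m./2; set b := n./2.
have -> : (a.*2.+1 * b.*2.+1)./2 = ((a * b).*2 + (a + b))%N by nia.
by rewrite oddD odd_double; congr (nat_of_bool (odd _)); lia.
Qed.

Lemma jacobiN1 (n : nat) : (0 < n)%N -> odd n -> jacobi (-1) n = (-1) ^+ n./2.
Proof.
move=> n_gt0 n_odd; rewrite /jacobi [in RHS](prod_prime_decomp n_gt0).
rewrite prime_decompE big_map /=.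
(* Oddness of the partial products is part of the invariant, since [signr_halfM] needs it. *)
suff [] : odd (\prod_(p <- primes n) p ^ logn p n) /\
  \prod_(p <- primes n) legendre (-1) p ^+ logn p n =
  (-1) ^+ (\prod_(p <- primes n) p ^ logn p n)./2 by [].
rewrite big_seq [X in X = _]big_seq.
apply: (big_ind2 (fun (m : nat) (z : int) => odd m /\ z = (-1) ^+ m./2)).
- by [].
- by move=> m1 z1 m2 z2 [o1 ->] [o2 ->]; rewrite oddM o1 o2 signr_halfM.
move=> p; rewrite mem_primes => /and3P[p_pr _ p_dvd].
have p_odd : odd p := dvdn_odd p_dvd n_odd.
elim: (logn p n) => // e [oe IH].
by rewrite expnS oddM p_odd oe signr_halfM // -IH exprS legendreN1.
Qed.

(** * Trigonometric identities and telescoping sums *)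

Section Trigo.
Variable R : realType.
Implicit Types x y : R.

Lemma mul2_cos_cos x y : 2 * cos x * cos y = cos (y - x) + cos (y + x).
Proof. by rewrite cosB cosD; ring. Qed.

Lemma mul2_sin_cos x y : 2 * sin x * cos y = sin (y + x) - sin (y - x).
Proof. by rewrite sinB sinD; ring. Qed.

Lemma cosMn_N1 x (n : nat) : cos x = -1 -> cos (x *+ n) = (-1) ^+ n.
Proof.
move=> cx; have sx : sin x = 0 by apply: cos1sin0; rewrite cx normrN1.
by elim: n => [|n IH]; rewrite ?cos0 // mulrS cosD sx cx IH exprS mul0r subr0.
Qed.

Lemma mul_cos_alternating_sum x (n : nat) : odd n -> cos (x *+ n) = 1 ->
  cos x * (\sum_(0 <= k < n) (-1) ^+ k * cos (x *+ k.*2.+1)) = 1.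
Proof.
(* Twice the [k]-th term is [f k.+1 - f k]; as [n] is odd, [f n = 1] while [f 0 = -1], so the total
   is 2. *)
move=> n_odd cn; pose f k := - ((-1) ^+ k * cos (x *+ k.*2)).
have cn2 : cos (x *+ n.*2) = 1 by rewrite -muln2 mulrnA cos_mulr2n cn; ring.
apply: (@mulfI _ 2); first by rewrite pnatr_eq0.
transitivity (\sum_(0 <= k < n) (f k.+1 - f k)).
  rewrite mulr_sumr mulr_sumr; apply: eq_bigr => k _.
  have -> : 2 * (cos x * ((-1) ^+ k * cos (x *+ k.*2.+1))) =
    (-1) ^+ k * (2 * cos x * cos (x *+ k.*2.+1)) by ring.
  by rewrite mul2_cos_cos /f doubleS !mulrSr addrK exprS; ring.
rewrite telescope_sumr // /f cn2 mulr0n cos0 -signr_odd n_odd; ring.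
Qed.

Lemma cos_neq0_cosMn x (n : nat) : odd n -> cos (x *+ n) = 1 -> cos x != 0.
Proof.
move=> n_odd /(mul_cos_alternating_sum _ _ n_odd) e; apply: contra_eq_neq e => ->.
by rewrite mul0r eq_sym oner_eq0.
Qed.

Lemma addr1_cos_neq0 x (n : nat) : odd n -> cos (x *+ n) = 1 -> 1 + cos x != 0.
Proof.
move=> n_odd; apply: contra_eq_neq => /eqP; rewrite addrC addr_eq0 => /eqP cx.
by rewrite cosMn_N1 // -signr_odd n_odd expr1; lra.
Qed.

Lemma cosMn_2pi (m : nat) : cos (pi *+ 2 *+ m : R) = 1.
Proof. by rewrite -[X in cos X]add0r (periodicn (@cosD2pi R)) cos0. Qed.

(** Multiplication by [2 * sin x] makes the sum telescope, and its end values are sines at arguments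
    differing by a multiple of 2 pi. *)
Lemma sum_cos_equidistributed x (n m : nat) : sin x != 0 -> x *+ n = pi *+ m ->
  \sum_(0 <= r < n) cos (x *+ r.*2) = 0.
Proof.
move=> sx xn; apply: (@mulfI _ (2 * sin x)); first by rewrite mulf_neq0 // pnatr_eq0.
rewrite mulr0 mulr_sumr; pose g r := sin (x *+ r.*2 - x).
rewrite (eq_bigr (fun r => g r.+1 - g r)) => [|r _]; last first.
  by rewrite mul2_sin_cos /g doubleS !mulrSr addrK.
rewrite telescope_sumr // /g -muln2 mulrnA xn mulrnAC [_ - x]addrC.
by rewrite (periodicn (@sinD2pi R)) mulr0n add0r subrr.
Qed.

(** The range extends to [n.*2] to cover [m = 2k + 1] with [k < n]; beyond [n], translation by pi
    reduces to arguments in (0, pi). *)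
Lemma sin_div_neq0 (n m : nat) : (0 < m < n.*2)%N -> m != n ->
  sin (pi * m%:R / n%:R : R) != 0.
Proof.
move=> /andP[m0 mn2] mn.
have n0 : (0 : R) < n%:R by rewrite ltr0n; lia.
have pi0 := pi_gt0 R.
have pos k : (0 < k < n)%N -> sin (pi * k%:R / n%:R : R) != 0.
  move=> /andP[k0 kn]; rewrite gt_eqF // sin_gt0_pi //.
  apply/andP; split; first by rewrite divr_gt0 // mulr_gt0 // ltr0n.
  by rewrite ltr_pdivrMr // ltr_pM2l // ltr_nat.
have [lt_mn|le_nm] := ltnP m n; first by apply: pos; rewrite m0.
rewrite -(subnK le_nm) natrD mulrDr mulrDl mulfK ?(gt_eqF n0) //.
by rewrite sinDpi oppr_eq0; apply: pos; lia.
Qed.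

End Trigo.

(** * Sums over the multiples of 2 pi / n *)

Lemma sum_shift_periodic (V : zmodType) (F : nat -> V) (n m : nat) :
  (forall r, F (r + n)%N = F r) ->
  \sum_(0 <= r < n) F (r + m)%N = \sum_(0 <= r < n) F r.
Proof.
move=> Fn; elim: m => [|m <-]; first by under eq_bigr do rewrite addn0.
(* One further shift changes the sum by a telescoping sum, [F (n + m) - F m], which vanishes by
   periodicity. *)
apply/eqP; rewrite -subr_eq0 -sumrB.
under eq_bigr do rewrite addnS -addSn.
by rewrite (telescope_sumr (fun r => F (r + m)%N)) // addnC Fn add0n subrr.
Qed.

Section RootSums.
Variables (R : realType) (n : nat).
Hypothesis n_odd : odd n.

Let n_gt0 : (0 < n)%N := odd_gt0 n_odd.
Let n_neq0 : n%:R != 0 :> R. Proof. by rewrite pnatr_eq0 -lt0n. Qed.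

Definition angle (r : nat) : R := 2 * pi * (r%:R / n%:R).

Lemma angleD r s : angle (r + s) = angle r + angle s.
Proof. by rewrite /angle natrD; field. Qed.

Lemma angle_n : angle n = pi *+ 2.
Proof. by rewrite /angle divff // mulr1 mulr_natl. Qed.

Lemma cos_angleMn r : cos (angle r *+ n) = 1.
Proof.
rewrite -(cosMn_2pi R r) /angle; congr cos.
by rewrite -mulr_natl -[pi *+ 2 *+ r]mulr_natl -[pi *+ 2]mulr_natl; field.
Qed.

Lemma sum_angle_shift (h : R -> R) (m : nat) : periodic h (pi *+ 2) ->
  \sum_(0 <= r < n) h (angle (r + m)) = \sum_(0 <= r < n) h (angle r).
Proof.
move=> hp; apply: (sum_shift_periodic _ (fun r => h (angle r))) => r.
by rewrite angleD angle_n hp.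
Qed.

(** Reversal sends [r] to [n - 1 - r], whose angle is opposite to that of [r + 1] modulo 2 pi. A
    shift by one then shows that the sum equals its own opposite. *)
Lemma sum_angle_odd (h : R -> R) : periodic h (pi *+ 2) ->
  (forall x, h (- x) = - h x) -> \sum_(0 <= r < n) h (angle r) = 0.
Proof.
move=> hp hN; set S := LHS.
suff : S = - S by lra.
rewrite {1}/S big_nat_rev add0n /S -(sum_angle_shift _ 1 hp) -sumrN.
apply: eq_big_nat => r /andP[_ rn]; rewrite -hN -[RHS]hp addn1 -angle_n.
by rewrite -{2}(subnK rn) addrC angleD addrK.
Qed.

Lemma sum_cos_angleM (k : nat) : (k < n)%N ->
  \sum_(0 <= r < n) cos (angle r *+ k.*2.+1) = if k == n./2 then n%:R else 0.
Proof.
move=> kn; have [->|k_neq] := eqVneq.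
  have -> : n./2.*2.+1 = n by rewrite -[RHS]odd_double_half n_odd.
  under eq_bigr do rewrite cos_angleMn.
  by rewrite sumr_const_nat subn0.
(* With this [x], the argument of the [r]-th cosine is [2r] times [x], and [sin x] is nonzero
   because [2k + 1] differs from [n]. *)
pose x : R := pi * k.*2.+1%:R / n%:R.
rewrite (eq_bigr (fun r => cos (x *+ r.*2))) => [|r _].
  apply: (sum_cos_equidistributed _ _ _ (k.*2.+1)).
    by apply: sin_div_neq0; lia.
  by rewrite -mulr_natr -[RHS]mulr_natr /x; field.
congr cos; rewrite -mulr_natr -[RHS]mulr_natr /x /angle -(mul2n r) natrM.
by field.
Qed.

Lemma sum_sec_angle :
  \sum_(0 <= r < n) (cos (angle r))^-1 = (-1) ^+ n./2 * n%:R.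
Proof.
transitivity (\sum_(0 <= r < n) \sum_(0 <= k < n)
    (-1) ^+ k * cos (angle r *+ k.*2.+1)).
  apply: eq_bigr => r _; have cr := cos_angleMn r.
  have c0 := cos_neq0_cosMn _ _ _ n_odd cr.
  by apply: (mulfI c0); rewrite mul_cos_alternating_sum // mulfV.
rewrite exchange_big_nat /=.
rewrite (eq_big_nat _ _
  (F2 := fun k => (-1) ^+ k * if k == n./2 then n%:R else 0)); last first.
  by move=> k kn; rewrite -mulr_sumr sum_cos_angleM.
have n2 : (n./2 < n)%N by lia.
rewrite big_mkord (bigD1 (Ordinal n2)) //= eqxx big1 ?addr0 // => k.
by rewrite -val_eqE /= => /negbTE ->; rewrite mulr0.
Qed.

(* Since (1 + c + s)(1 + c - s) = 2 c (1 + c), the summand is half of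
   1 / c minus an odd function of the angle; [e] is a sign. *)
Lemma sum_inv_angle (e : R) : e ^+ 2 = 1 ->
  \sum_(0 <= r < n) 1 / (1 + e * sin (angle r) + cos (angle r)) =
  (-1) ^+ n./2 * (n%:R / 2).
Proof.
move=> e2; pose h x : R := e / 2 * (sin x / (cos x * (1 + cos x))).
rewrite (eq_bigr (fun r => 2^-1 * (cos (angle r))^-1 - h (angle r))) => [|r _].
  rewrite sumrB sum_angle_odd.
  - by rewrite subr0 -mulr_sumr sum_sec_angle; field.
  - by move=> x; rewrite /h sinD2pi cosD2pi.
  - by move=> x; rewrite /h sinN cosN; ring.
have cr := cos_angleMn r.
have c0 := cos_neq0_cosMn _ _ _ n_odd cr.
have c1 := addr1_cos_neq0 _ _ _ n_odd cr.
have := sin2cos2 (angle r); rewrite /h.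
move: (cos _) (sin _) c0 c1 => c s c0 c1 s2.
have prod : (1 + e * s + c) * (1 + c - e * s) = 2 * c * (1 + c).
  transitivity ((1 + c) ^+ 2 - e ^+ 2 * s ^+ 2); first ring.
  by rewrite e2 s2; ring.
(* The denominator divides [2 * c * (1 + c)], whose factors are all nonzero. *)
have d0 : 1 + e * s + c != 0.
  apply/eqP => d0; move/eqP: prod; rewrite d0 mul0r eq_sym.
  by rewrite !mulf_eq0 pnatr_eq0 (negbTE c0) (negbTE c1).
apply: (mulIf d0); rewrite mul1r mulVf //.
apply: (@mulfI _ (2 * c * (1 + c))); first by rewrite !mulf_neq0 // pnatr_eq0.
rewrite mulr1 -{1}prod; field.
by rewrite c0 c1.
Qed.

(** As [n] is odd, a shift of [r] by [(n + 1) / 2] adds [pi + pi / n] to the angle; subtracting pi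
    leaves the odd multiple of [pi / n]. *)
Lemma sum_odd_angle (h : R -> R) : periodic h (pi *+ 2) ->
  \sum_(0 <= r < n) h (pi * ((2 * r + 1)%:R / n%:R)) =
  \sum_(0 <= r < n) h (angle r - pi).
Proof.
move=> hp; rewrite -(sum_angle_shift (fun x => h (x - pi)) (n./2).+1); last first.
  by move=> x; rewrite addrAC hp.
apply: eq_bigr => r _; congr h; rewrite /angle.
have -> : n%:R = 2 * n./2%:R + 1 :> R.
  by rewrite -{1}(odd_double_half n) n_odd addnC addn1 -mul2n -natr1 natrM.
field.
by rewrite -natrM natr1 pnatr_eq0.
Qed.

End RootSums.

Theorem corollary1p2 (R : realType) (n : nat) (n_gt0 : (0 < n)%N)
    (n_odd : odd n) :
  [/\ \sum_(0 <= r < n)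
        1 / (1 + sin (2%:R * pi * r%:R / n%:R) + cos (2%:R * pi * r%:R / n%:R))
        = (jacobi (-1) n)%:~R * (n%:R / 2%:R) :> R,
      \sum_(0 <= r < n)
        1 / (1 + sin (pi * (2 * r + 1)%:R / n%:R)
               - cos (pi * (2 * r + 1)%:R / n%:R))
        = (jacobi (-1) n)%:~R * (n%:R / 2%:R) :> R,
      \sum_(0 <= r < n) sec (2%:R * pi * (r%:R / n%:R))
        = (jacobi (-1) n)%:~R * n%:R :> R
    & \sum_(0 <= r < n) sec (pi * ((2 * r + 1)%:R / n%:R))
        = - (jacobi (-1) n)%:~R * n%:R :> R].
Proof.
have sinBpi (x : R) : sin (x - pi) = - sin x by rewrite sinB cospi sinpi; ring.
have cosBpi (x : R) : cos (x - pi) = - cos x by rewrite cosB cospi sinpi; ring.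
have -> : (jacobi (-1) n)%:~R = (-1) ^+ n./2 :> R.
  by rewrite jacobiN1 // rmorphXn rmorphN1.
split.
- rewrite -(sum_inv_angle _ _ n_odd 1) ?expr1n //.
  by apply: eq_bigr => r _; rewrite [1 * sin _]mul1r /angle mulrA.
(* Translation by pi negates both [sin] and [cos], so [1 + sin - cos] becomes [1 - sin + cos], the
   case of sign -1. *)
- rewrite -(sum_inv_angle _ _ n_odd (-1)) ?sqrrN ?expr1n //.
  under eq_bigr do rewrite -mulrA.
  rewrite (sum_odd_angle _ _ n_odd (fun x => 1 / (1 + sin x - cos x))).
    by apply: eq_bigr => r _; rewrite sinBpi cosBpi opprK mulN1r.
  by move=> x; rewrite sinD2pi cosD2pi.
- exact: sum_sec_angle.
- rewrite (sum_odd_angle _ _ n_odd sec) => [|x]; last by rewrite /sec cosD2pi.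
  rewrite mulNr -sum_sec_angle // -sumrN.
  by apply: eq_bigr => r _; rewrite /sec cosBpi invrN.
Qed.
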